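(* Let spacetime be $\mathrm{E}\times \mathrm{T}=\mathbf{R}^3\times\mathbf{R}$, with points $(r,t)$. A bijection $g:\mathbf{R}^3\times\mathbf{R}\to\mathbf{R}^3\times\mathbf{R}$ is an Aristotelian transformation (that is, $g$ exchanges resting motions, exchanges sheets of simultaneous events, and preserves the Euclidean distances on the set of resting motions and on the set of sheets of simultaneous events) if and only if there exist $A\in \mathrm{O}(3)$, $C\in\mathbf{R}^3$, $e\in\mathbf{R}$ and a sign $\varepsilon\in\{+1,-1\}$ such that $$g(r,t)=(Ar+C,\ \varepsilon t+e)\qquad\text{for all }(r,t)\in\mathbf{R}^3\times\mathbf{R}.$$ Equivalently, identifying $(r,t)$ with the column vector $(r,t,1)$, the group of Aristotle is the group of matrices $$\begin{pmatrix} A & 0 & C\\ 0 & \pm 1 & e\\ 0&0&1\end{pmatrix},\qquad A\in \mathrm{O}(3),\ C\in\mathbf{R}^3,\ e\in\mathbf{R}.$$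
   Context: $\mathrm{E}=\mathbf{R}^3$ and $\mathrm{T}=\mathbf{R}$ carry their standard Euclidean distances. For $r\in\mathrm{E}$, the resting motion at $r$ is the subset $\mathbf{r}=\{(r,t)\mid t\in \mathrm{T}\}$ of $\mathrm{E}\times\mathrm{T}$; the set of resting motions is $\mathbf{E}=\{\mathbf{r}\mid r\in \mathrm{E}\}$, with distance $d(\mathbf{r},\mathbf{r}')=\|r'-r\|$ (standard Euclidean norm). For $t\in \mathrm{T}$, the sheet of simultaneous events at $t$ is the subset $\mathbf{t}=\{(r,t)\mid r\in \mathrm{E}\}$; the set of these sheets is $\mathbf{T}=\{\mathbf{t}\mid t\in \mathrm{T}\}$, with distance $d(\mathbf{t},\mathbf{t}')=|t'-t|$. An Aristotelian transformation is an automorphism (bijection) $g$ of $\mathrm{E}\times \mathrm{T}$ such that: (1) the image by $g$ of every resting motion $\mathbf{r}$ is a resting motion $g(\mathbf{r})$; (2) the image by $g$ of every sheet of simultaneous events $\mathbf{t}$ is a sheet of simultaneous events $g(\mathbf{t})$; (3) $d(g(\mathbf{r}),g(\mathbf{r}'))=d(\mathbf{r},\mathbf{r}')$ for all $\mathbf{r},\mathbf{r}'\in\mathbf{E}$ and $d(g(\mathbf{t}),g(\mathbf{t}'))=d(\mathbf{t},\mathbf{t}')$ for all $\mathbf{t},\mathbf{t}'\in\mathbf{T}$. The group of Aristotle is the group of all Aristotelian transformations. *)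

(* Defs.v *)
From mathcomp Require Import all_boot all_order all_algebra.
From mathcomp Require Import all_classical all_reals.
Set Implicit Arguments.
Unset Strict Implicit.
Unset Printing Implicit Defensive.
Import Order.TTheory GRing.Theory Num.Theory.
Local Open Scope classical_set_scope.
Local Open Scope ring_scope.

Definition spacetime (R : realType) : Type := ('cV[R]_3 * R)%type.

(* The norm that MathComp-Analysis puts on matrices is the sup norm, hence this
   Euclidean one. *)
Definition eucl_norm (R : realType) (n : nat) (v : 'cV[R]_n) : R :=
  Num.sqrt (\sum_(i < n) v i 0 ^+ 2).

Definition resting_motion (R : realType) (r : 'cV[R]_3) : set (spacetime R) :=
  [set (r, t) | t in [set: R]].

Definition sheet (R : realType) (t : R) : set (spacetime R) :=
  [set (r, t) | r in [set: 'cV[R]_3]].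

Definition resting_motions (R : realType) : set (set (spacetime R)) :=
  range (@resting_motion R).

Definition sheets (R : realType) : set (set (spacetime R)) :=
  range (@sheet R).

Arguments resting_motions : clear implicits.
Arguments sheets : clear implicits.

(* The point r of a resting motion m = resting_motion r; junk value 0 if m is
   not a resting motion.  Similarly for sheets. *)
Definition place (R : realType) (m : set (spacetime R)) : 'cV[R]_3 :=
  xget 0 [set r | m = resting_motion r].

Definition date (R : realType) (s : set (spacetime R)) : R :=
  xget 0 [set t | s = sheet t].

Definition dist_motions (R : realType) (m m' : set (spacetime R)) : R :=
  eucl_norm (place m' - place m).

Definition dist_sheets (R : realType) (s s' : set (spacetime R)) : R :=
  `|date s' - date s|.

Lemma placeK (R : realType) : cancel (@resting_motion R) (@place R).
Proof.
move=> r; rewrite /place; case: xgetP => [r' _ /= e|/(_ r) /= ne]; last by case: ne.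
have : resting_motion r (r, 0) by exists 0.
by rewrite e => -[t _ [->]].
Qed.

Lemma dateK (R : realType) : cancel (@sheet R) (@date R).
Proof.
move=> t; rewrite /date; case: xgetP => [t' _ /= e|/(_ t) /= ne]; last by case: ne.
have : sheet t (0, t) by exists 0.
by rewrite e => -[r _ [_ ->]].
Qed.

Lemma dist_motionsE (R : realType) (r r' : 'cV[R]_3) :
  dist_motions (resting_motion r) (resting_motion r') = eucl_norm (r' - r).
Proof. by rewrite /dist_motions !placeK. Qed.

Lemma dist_sheetsE (R : realType) (t t' : R) :
  dist_sheets (sheet t) (sheet t') = `|t' - t|.
Proof. by rewrite /dist_sheets !dateK. Qed.

Record aristotelian (R : realType) (g : spacetime R -> spacetime R) : Prop :=
  Aristotelian {
    aristotelian_bij : bijective g;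
    aristotelian_motions :
      forall m, resting_motions R m -> resting_motions R (g @` m);
    aristotelian_sheets : forall s, sheets R s -> sheets R (g @` s);
    aristotelian_dist_motions :
      forall m m', resting_motions R m -> resting_motions R m' ->
        dist_motions (g @` m) (g @` m') = dist_motions m m';
    aristotelian_dist_sheets :
      forall s s', sheets R s -> sheets R s' ->
        dist_sheets (g @` s) (g @` s') = dist_sheets s s'
  }.

Definition aristotle_group (R : realType) :
    set (spacetime R -> spacetime R) :=
  [set g | aristotelian g].

Arguments aristotle_group : clear implicits.

Definition orthogonal_mx (R : realType) (n : nat) (A : 'M[R]_n) : Prop :=
  A^T *m A = 1%:M.

Definition is_sign (R : realType) (eps : R) : Prop := eps = 1 \/ eps = -1.

Definition homogeneous (R : realType) (x : spacetime R) :
    'cV[R]_(3 + (1 + 1)) :=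
  col_mx x.1 (col_mx x.2%:M 1%:M).

Definition aristotle_mx (R : realType)
    (A : 'M[R]_3) (C : 'cV[R]_3) (eps e : R) : 'M[R]_(3 + (1 + 1)) :=
  block_mx A                    (row_mx (0 : 'cV[R]_3) C)
           (0 : 'M[R]_(1 + 1, 3)) (block_mx eps%:M e%:M
                                            0      1%:M).

Definition aristotle_matrices (R : realType) : set 'M[R]_(3 + (1 + 1)) :=
  [set M | exists (A : 'M[R]_3) (C : 'cV[R]_3) (eps e : R),
     [/\ orthogonal_mx A, is_sign eps & M = aristotle_mx A C eps e]].

Arguments aristotle_matrices : clear implicits.

Definition transformation_group (T : Type) (G : set (T -> T)) : Prop :=
  [/\ G id,
      forall g h, G g -> G h -> G (g \o h)
    & forall g, G g -> exists h, [/\ G h, cancel g h & cancel h g]].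

Definition matrix_group (R : realType) (n : nat) (G : set 'M[R]_n) : Prop :=
  [/\ forall M, G M -> M \in unitmx,
      G 1%:M,
      forall M N, G M -> G N -> G (M *m N)
    & forall M, G M -> G (invmx M)].

(* Main.v *)
Require Import Defs.
From mathcomp Require Import all_boot all_order all_algebra.
From mathcomp Require Import all_classical all_reals.
From mathcomp Require Import ring lra.
Set Implicit Arguments.
Unset Strict Implicit.
Unset Printing Implicit Defensive.
Import Order.TTheory GRing.Theory Num.Theory.
Local Open Scope classical_set_scope.
Local Open Scope ring_scope.

(** An Aristotelian transformation acts on resting motions and on sheets
    separately, so it has the form [(r, t) |-> (f r, k t)] with [f] and [k]
    distance preserving.  A distance-preserving [f] on R^n satisfies
    [f x = A x + f 0], where [A] is the matrix with columns [f e_j - f 0]: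
    polarization shows that [h := f - f 0] preserves the scalar product, so
    [A^T A = 1] and the coordinates [h e_j . h x = e_j . x] of [A^T (h x)] are
    those of [x].  In homogeneous coordinates affine maps become matrices. *)

(** * Isometries of R^n and of the real line *)

Lemma eucl_norm_ge0 (R : realType) n (v : 'cV[R]_n) : 0 <= eucl_norm v.
Proof. exact: sqrtr_ge0. Qed.

Lemma eucl_norm_sqr (R : realType) n (v : 'cV[R]_n) :
  eucl_norm v ^+ 2 = (v^T *m v) 0 0.
Proof.
rewrite sqr_sqrtr ?sumr_ge0 // => [|i _]; last exact: sqr_ge0.
by rewrite mxE; apply: eq_bigr => i _; rewrite mxE expr2.
Qed.

Lemma eucl_norm_polar (R : realType) n (u v : 'cV[R]_n) :
  (u^T *m v) 0 0 *+ 2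
  = eucl_norm u ^+ 2 + eucl_norm v ^+ 2 - eucl_norm (u - v) ^+ 2.
Proof.
have uvC : (v^T *m u) 0 0 = (u^T *m v) 0 0.
  by rewrite -[u in LHS]trmxK -trmx_mul mxE.
rewrite !eucl_norm_sqr [(u - v)^T]linearB /= mulmxBl !mulmxBr.
by move: uvC; rewrite !mxE => ->; ring.
Qed.

Lemma isometry_affine (R : realType) n (f : 'cV[R]_n -> 'cV[R]_n) :
  (forall x y, eucl_norm (f x - f y) = eucl_norm (x - y)) ->
  exists A : 'M[R]_n, orthogonal_mx A /\ forall x, f x = A *m x + f 0.
Proof.
move=> fiso; pose h x := f x - f 0.
have hnorm x : eucl_norm (h x) = eucl_norm x by rewrite fiso subr0.
have hsub x y : eucl_norm (h x - h y) = eucl_norm (x - y).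
  by rewrite /h opprB addrA subrK fiso.
have hdot x y : ((h x)^T *m h y) 0 0 = (x^T *m y) 0 0.
  have /eqP := eucl_norm_polar (h x) (h y).
  by rewrite !hnorm hsub -eucl_norm_polar eqrMn2r //= => /eqP.
pose A : 'M[R]_n := \matrix_(i, j) h (delta_mx j 0) i 0.
have Ah x : A^T *m h x = x.
  apply/colP => j.
  have -> : (A^T *m h x) j 0 = ((h (delta_mx j 0))^T *m h x) 0 0.
    by rewrite !mxE; apply: eq_bigr => i _; rewrite !mxE.
  by rewrite hdot trmx_delta -rowE mxE.
(* Column [j] of [A] is [h e_j], so [Ah] at the basis vectors says that the columns of [A^T *m A]
   are the [e_j]. *)
have orthA : orthogonal_mx A.
  apply/matrixP => i j.
  have -> : (A^T *m A) i j = (A^T *m h (delta_mx j 0)) i 0.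
    by rewrite !mxE; apply: eq_bigr => k _; rewrite !mxE.
  by rewrite Ah !mxE andbT.
exists A; split=> // x.
(* For a square matrix [A^T *m A = 1] gives [A *m A^T = 1], which turns [A^T *m h x = x] into
   [A *m x = h x]. *)
by rewrite -[x in A *m x]Ah mulmxA (mulmx1C orthA) mul1mx subrK.
Qed.

Lemma real_isometry_affine (R : realType) (k : R -> R) :
  (forall s t, `|k s - k t| = `|s - t|) ->
  exists eps : R, is_sign eps /\ forall t, k t = eps * t + k 0.
Proof.
move=> kiso.
have ksqr s t : (k s - k t) ^+ 2 = (s - t) ^+ 2.
  by rewrite -[LHS]real_normK ?num_real // kiso real_normK ?num_real.
have epsE : (k 1 - k 0) ^+ 2 = 1 by rewrite ksqr subr0 expr1n.
exists (k 1 - k 0); split.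
  by move/eqP: epsE; rewrite sqrf_eq1 => /orP[]/eqP; [left|right].
move=> t; have h0 := ksqr t 0; have h1 := ksqr t 1.
(* Polarization in dimension one: twice the left side is [1 + t^2 - (t - 1)^2 = 2t]. As [k 1 - k 0]
   squares to 1, multiplying by it then isolates [k t - k 0]. *)
have prodE : (k 1 - k 0) * (k t - k 0) = t by lra.
by rewrite -{2}prodE mulrA -expr2 epsE mul1r subrK.
Qed.

(** * Closure properties of signs and orthogonal matrices *)

Lemma is_sign_sqr (R : realType) (eps : R) : is_sign eps -> eps * eps = 1.
Proof. by case=> ->; rewrite ?mulrNN mulr1. Qed.

Lemma is_signM (R : realType) (a b : R) :
  is_sign a -> is_sign b -> is_sign (a * b).
Proof.
by case=> -> [->|->]; rewrite ?mulrNN ?mulr1 ?mul1r; [left|right|right|left].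
Qed.

Lemma is_sign_norm (R : realType) (eps : R) : is_sign eps -> `|eps| = 1.
Proof. by case=> ->; rewrite ?normrN normr1. Qed.

Lemma orthogonal_mx1 (R : realType) n : orthogonal_mx (1%:M : 'M[R]_n).
Proof. by rewrite /orthogonal_mx trmx1 mulmx1. Qed.

Lemma orthogonal_mxM (R : realType) n (A B : 'M[R]_n) :
  orthogonal_mx A -> orthogonal_mx B -> orthogonal_mx (A *m B).
Proof.
rewrite /orthogonal_mx => oA oB.
by rewrite trmx_mul mulmxA -(mulmxA B^T) oA mulmx1.
Qed.

Lemma orthogonal_mx_tr (R : realType) n (A : 'M[R]_n) :
  orthogonal_mx A -> orthogonal_mx A^T.
Proof. by rewrite /orthogonal_mx trmxK; exact: mulmx1C. Qed.

Lemma orthogonal_mx_norm (R : realType) n (A : 'M[R]_n) (v : 'cV[R]_n) :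
  orthogonal_mx A -> eucl_norm (A *m v) = eucl_norm v.
Proof.
move=> oA; apply/eqP; rewrite -(@eqrXn2 _ 2) ?eucl_norm_ge0 //.
by rewrite !eucl_norm_sqr trmx_mul mulmxA -(mulmxA v^T) oA mulmx1.
Qed.

(** * The explicit affine maps and the characterization of Aristotelian transformations *)

Definition aristotle_map (R : realType) (A : 'M[R]_3) (C : 'cV[R]_3)
    (eps e : R) (x : spacetime R) : spacetime R :=
  (A *m x.1 + C, eps * x.2 + e).

Lemma aristotle_map1 (R : realType) : @aristotle_map R 1%:M 0 1 0 = id.
Proof.
by apply/funext => -[r t]; rewrite /aristotle_map /= mul1mx mul1r !addr0.
Qed.

Lemma aristotle_map_comp (R : realType) A C eps e A' C' eps' e' :
  @aristotle_map R A C eps e \o @aristotle_map R A' C' eps' e'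
  = aristotle_map (A *m A') (A *m C' + C) (eps * eps') (eps * e' + e).
Proof.
apply/funext => -[r t]; rewrite /aristotle_map /=.
by rewrite mulmxDr mulrDr mulmxA mulrA !addrA.
Qed.

(** The inverse parameters come from solving [r' = A r + C] and [t' = eps t + e], with [A^T] inverse
    to [A] and [eps] its own inverse. *)
Lemma aristotle_mapK (R : realType) (A : 'M[R]_3) C eps e :
  orthogonal_mx A -> is_sign eps ->
  cancel (aristotle_map A C eps e)
         (aristotle_map A^T (- (A^T *m C)) eps (- (eps * e))).
Proof.
move=> oA /is_sign_sqr eps2 x; rewrite -[LHS]/((_ \o _) x) aristotle_map_comp.
by rewrite oA eps2 !subrr aristotle_map1.
Qed.

Lemma aristotle_mapVK (R : realType) (A : 'M[R]_3) C eps e :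
  orthogonal_mx A -> is_sign eps ->
  cancel (aristotle_map A^T (- (A^T *m C)) eps (- (eps * e)))
         (aristotle_map A C eps e).
Proof.
move=> oA /is_sign_sqr eps2 x; rewrite -[LHS]/((_ \o _) x) aristotle_map_comp.
rewrite (mulmx1C oA) eps2 mulmxN mulrN mulmxA mulrA (mulmx1C oA) eps2.
by rewrite mul1mx mul1r !addNr aristotle_map1.
Qed.

Lemma aristotle_map_motion (R : realType) (A : 'M[R]_3) C eps e r :
  is_sign eps ->
  aristotle_map A C eps e @` resting_motion r = resting_motion (A *m r + C).
Proof.
move=> /is_sign_sqr eps2; apply/seteqP; split=> [_ [_ [t _ <-] <-]|_ [t _ <-]].
  by exists (eps * t + e).
(* The date is the solution [s] of [eps * s + e = t]. *)
exists (r, eps * (t - e)); first by exists (eps * (t - e)).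
by rewrite /aristotle_map /= mulrA eps2 mul1r subrK.
Qed.

Lemma aristotle_map_sheet (R : realType) (A : 'M[R]_3) C eps e t :
  orthogonal_mx A ->
  aristotle_map A C eps e @` sheet t = sheet (eps * t + e).
Proof.
move=> oA; apply/seteqP; split=> [_ [_ [r _ <-] <-]|_ [r _ <-]].
  by exists (A *m r + C).
exists (A^T *m (r - C), t); first by exists (A^T *m (r - C)).
by rewrite /aristotle_map /= mulmxA (mulmx1C oA) mul1mx subrK.
Qed.

Lemma aristotelian_map (R : realType) (A : 'M[R]_3) C eps e :
  orthogonal_mx A -> is_sign eps -> aristotelian (aristotle_map A C eps e).
Proof.
move=> oA seps; split.
- exact: (Bijective (aristotle_mapK C e oA seps)
                    (aristotle_mapVK C e oA seps)).
- by move=> _ [r _ <-]; rewrite aristotle_map_motion //; exists (A *m r + C).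
- by move=> _ [t _ <-]; rewrite aristotle_map_sheet //; exists (eps * t + e).
- move=> _ _ [r _ <-] [r' _ <-].
  rewrite !aristotle_map_motion // !dist_motionsE.
  by rewrite opprD addrACA subrr addr0 -mulmxBr orthogonal_mx_norm.
- move=> _ _ [t _ <-] [t' _ <-]; rewrite !aristotle_map_sheet // !dist_sheetsE.
  by rewrite opprD addrACA subrr addr0 -mulrBr normrM (is_sign_norm seps) mul1r.
Qed.

Lemma aristotelianP (R : realType) (g : spacetime R -> spacetime R) :
  aristotelian g <->
  exists A C e eps,
    [/\ orthogonal_mx A, is_sign eps & g = aristotle_map A C eps e].
Proof.
split=> [[_ gm gs gdm gds]|[A [C [e [eps [oA seps ->]]]]]]; last first.
  exact: aristotelian_map.
(* The default value 0 of [place] and [date] never matters here: [gm] and [gs] make these images a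
   resting motion and a sheet. *)
pose f r := place (g @` resting_motion r).
pose k t := date (g @` sheet t).
have motionE r : g @` resting_motion r = resting_motion (f r).
  have [|r' _ gr] := gm (resting_motion r); first by exists r.
  by rewrite /f -gr placeK.
have sheetE t : g @` sheet t = sheet (k t).
  have [|t' _ gt] := gs (sheet t); first by exists t.
  by rewrite /k -gt dateK.
(* The event [(r, t)] lies on both the motion at [r] and the sheet at [t], so its image lies on both
   image sets, which meet only at [(f r, k t)]. *)
have gE r t : g (r, t) = (f r, k t).
  have : (g @` resting_motion r) (g (r, t)) by exists (r, t) => //; exists t.
  have : (g @` sheet t) (g (r, t)) by exists (r, t) => //; exists r.
  by rewrite motionE sheetE => -[r1 _ <-] [t1 _ [-> _]].
have fiso x y : eucl_norm (f x - f y) = eucl_norm (x - y).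
  by rewrite -!dist_motionsE -!motionE gdm //; [exists y|exists x].
have kiso s t : `|k s - k t| = `|s - t|.
  by rewrite -!dist_sheetsE -!sheetE gds //; [exists t|exists s].
have [A [oA fE]] := isometry_affine fiso.
have [eps [seps kE]] := real_isometry_affine kiso.
exists A, (f 0), (k 0), eps; split=> //.
by apply/funext => -[r t]; rewrite gE fE kE.
Qed.

Lemma transformation_group_aristotle (R : realType) :
  transformation_group (aristotle_group R).
Proof.
split.
- by rewrite -aristotle_map1; apply: aristotelian_map;
    [exact: orthogonal_mx1|left].
- move=> _ _ /aristotelianP[A [C [e [eps [oA seps ->]]]]]
             /aristotelianP[A' [C' [e' [eps' [oA' seps' ->]]]]].
  rewrite aristotle_map_comp.
  by apply: aristotelian_map; [exact: orthogonal_mxM|exact: is_signM].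
- move=> _ /aristotelianP[A [C [e [eps [oA seps ->]]]]].
  exists (aristotle_map A^T (- (A^T *m C)) eps (- (eps * e))); split.
  + by apply: aristotelian_map => //; exact: orthogonal_mx_tr.
  + exact: aristotle_mapK.
  + exact: aristotle_mapVK.
Qed.

(** * The matrix group and its identification with the group of Aristotle *)

Lemma aristotle_mx1 (R : realType) : @aristotle_mx R 1%:M 0 1 0 = 1%:M.
Proof.
by rewrite /aristotle_mx row_mx0 raddf0 -!scalar_mx_block.
Qed.

(** The parameters obey the same law as in [aristotle_map_comp]; hence passing from maps to matrices
    is multiplicative. *)
Lemma aristotle_mxM (R : realType) A C eps e A' C' eps' e' :
  @aristotle_mx R A C eps e *m @aristotle_mx R A' C' eps' e'
  = aristotle_mx (A *m A') (A *m C' + C) (eps * eps') (eps * e' + e).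
Proof.
rewrite /aristotle_mx mulmx_block mulmx0 addr0 !mul0mx mulmx0 !add0r.
rewrite mul_mx_row mul_row_block mulmx_block.
rewrite !(mulmx0, mul0mx, mulmx1, mul1mx, addr0, add0r) add_row_mx add0r.
by rewrite -!scalar_mxM raddfD.
Qed.

Lemma aristotle_mx_homogeneous (R : realType) A C eps e (x : spacetime R) :
  aristotle_mx A C eps e *m homogeneous x
  = homogeneous (aristotle_map A C eps e x).
Proof.
rewrite /aristotle_mx /homogeneous /aristotle_map /= !mul_block_col mul_row_col.
rewrite !(mulmx0, mul0mx, mulmx1, mul1mx, addr0, add0r).
by rewrite -scalar_mxM raddfD.
Qed.

Lemma homogeneous_inj (R : realType) : injective (@homogeneous R).
Proof.
move=> [r t] [r' t'] /eq_col_mx[/= -> /eq_col_mx[/matrixP/(_ 0 0)]].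
by rewrite !mxE !mulr1n => ->.
Qed.

Lemma aristotle_mxV (R : realType) (A : 'M[R]_3) C eps e :
  orthogonal_mx A -> is_sign eps ->
  aristotle_mx A^T (- (A^T *m C)) eps (- (eps * e)) *m aristotle_mx A C eps e
  = 1%:M.
Proof.
by move=> oA /is_sign_sqr eps2; rewrite aristotle_mxM oA eps2 !subrr aristotle_mx1.
Qed.

Lemma matrix_group_aristotle (R : realType) :
  matrix_group (aristotle_matrices R).
Proof.
split.
- move=> _ [A [C [eps [e [oA seps ->]]]]].
  by case: (mulmx1_unit (aristotle_mxV C e oA seps)).
- exists 1%:M, 0, 1, 0; rewrite aristotle_mx1.
  by split=> //; [exact: orthogonal_mx1|left].
- move=> _ _ [A [C [eps [e [oA seps ->]]]]] [A' [C' [eps' [e' [oA' seps' ->]]]]].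
  exists (A *m A'), (A *m C' + C), (eps * eps'), (eps * e' + e).
  by rewrite aristotle_mxM; split=> //; [exact: orthogonal_mxM|exact: is_signM].
- move=> _ [A [C [eps [e [oA seps ->]]]]].
  exists A^T, (- (A^T *m C)), eps, (- (eps * e)); split=> //.
    exact: orthogonal_mx_tr.
  have VM := aristotle_mxV C e oA seps.
  (* A left inverse [V] of the unit [M] equals [invmx M], since [V = (V *m M) *m invmx M]. *)
  by have [_ Mu] := mulmx1_unit VM; rewrite -[RHS](mulmxK Mu) VM mul1mx.
Qed.

(* [A], [C], [eps] and [e] are read off the images of the origin, of the basis
   vectors of space at date 0, and of the origin at date 1. *)
Definition mx_of_aristotle (R : realType) (g : spacetime R -> spacetime R) :
    'M[R]_(3 + (1 + 1)) :=
  aristotle_mx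
    (\matrix_(i, j) ((g (delta_mx j 0, 0)).1 - (g (0, 0)).1) i 0)
    (g (0, 0)).1 ((g (0, 1)).2 - (g (0, 0)).2) (g (0, 0)).2.

(** Through [aristotelianP], this computes [mx_of_aristotle] on every Aristotelian transformation.
    The matrix block is recovered because [A *m e_j] is column [j] of [A]. *)
Lemma mx_of_aristotle_map (R : realType) (A : 'M[R]_3) C eps e :
  mx_of_aristotle (aristotle_map A C eps e) = aristotle_mx A C eps e.
Proof.
rewrite /mx_of_aristotle /aristotle_map /= mulmx0 mulr0 mulr1 !add0r addrK.
congr aristotle_mx; apply/matrixP => i j.
by rewrite mxE addrK -colE mxE.
Qed.

Lemma mx_of_aristotle_homogeneous (R : realType) g (x : spacetime R) :
  aristotelian g -> homogeneous (g x) = mx_of_aristotle g *m homogeneous x.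
Proof.
move=> /aristotelianP[A [C [e [eps [_ _ ->]]]]].
by rewrite mx_of_aristotle_map aristotle_mx_homogeneous.
Qed.

Lemma mx_of_aristotle_bij (R : realType) :
  set_bij (aristotle_group R) (aristotle_matrices R) (@mx_of_aristotle R).
Proof.
split.
- move=> _ /aristotelianP[A [C [e [eps [oA seps ->]]]]].
  by exists A, C, eps, e; rewrite mx_of_aristotle_map.
(* The matrix determines the homogeneous coordinates of every image point, hence the map itself. *)
- move=> g h /set_mem Gg /set_mem Gh gh; apply/funext => x.
  by apply: homogeneous_inj; rewrite !mx_of_aristotle_homogeneous // gh.
- move=> _ [A [C [eps [e [oA seps ->]]]]].
  exists (aristotle_map A C eps e); last exact: mx_of_aristotle_map.
  exact: aristotelian_map.
Qed.

Lemma mx_of_aristotle_comp (R : realType) g h :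
  aristotle_group R g -> aristotle_group R h ->
  mx_of_aristotle (g \o h) = mx_of_aristotle g *m mx_of_aristotle h.
Proof.
move=> /aristotelianP[A [C [e [eps [_ _ ->]]]]].
move=> /aristotelianP[A' [C' [e' [eps' [_ _ ->]]]]].
by rewrite aristotle_map_comp !mx_of_aristotle_map aristotle_mxM.
Qed.

Theorem mainTheorem1 (R : realType) :
  (forall g : spacetime R -> spacetime R, bijective g ->
     (aristotelian g <->
      exists (A : 'M[R]_3) (C : 'cV[R]_3) (e eps : R),
        [/\ orthogonal_mx A, is_sign eps &
            forall (r : 'cV[R]_3) (t : R),
              g (r, t) = (A *m r + C, eps * t + e)]))
  /\
  [/\ transformation_group (aristotle_group R),
      matrix_group (aristotle_matrices R) &
      exists phi : (spacetime R -> spacetime R) -> 'M[R]_(3 + (1 + 1)),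
        [/\ set_bij (aristotle_group R) (aristotle_matrices R) phi,
            forall g h, aristotle_group R g -> aristotle_group R h ->
              phi (g \o h) = phi g *m phi h &
            forall g, aristotle_group R g -> forall x : spacetime R,
              homogeneous (g x) = phi g *m homogeneous x]].
Proof.
split=> [g _|].
  split=> [/aristotelianP|] [A [C [e [eps [oA seps gE]]]]].
    by exists A, C, e, eps; rewrite gE.
  apply/aristotelianP; exists A, C, e, eps; split=> //.
  by apply/funext => -[r t]; exact: gE.
split; [exact: transformation_group_aristotle|exact: matrix_group_aristotle|].
exists (@mx_of_aristotle R); split.
- exact: mx_of_aristotle_bij.
- exact: mx_of_aristotle_comp.
- by move=> g Gg x; exact: mx_of_aristotle_homogeneous.
Qed.
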